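(* Let $p,q,n$ be positive integers with $q\ge n$, and let $\lambda\in\mathrm{Par}(n,pq)$. Let $\rho_\lambda$ be the normalised projector onto the summand $U_\lambda\otimes V_\lambda$ of $(\mathbb{C}^{pq})^{\otimes n}=(\mathbb{C}^p\otimes\mathbb{C}^q)^{\otimes n}$. Then \[ \big\|\mathrm{tr}_{\mathbb{C}^q}\rho_\lambda-\tfrac{\mathcal{I}}{p^n}\big\|\le 2-2\Big(\frac{q-n+1}{q}\Big)^n=\frac{2n(n-1)}{q}+O(n^4/q^2), \] where $\mathcal{I}$ is the identity on $(\mathbb{C}^p)^{\otimes n}$.
   Context: $\mathrm{Par}(n,d)$ is the set of partitions of $n$ with at most $d$ rows. Schur–Weyl duality: $(\mathbb{C}^d)^{\otimes n}\cong\bigoplus_{\lambda\in\mathrm{Par}(n,d)}U_\lambda\otimes V_\lambda$, with $U_\lambda$ the irrep of $\mathcal{U}(d)$ (acting by $g^{\otimes n}$) of highest weight $\lambda$ and $V_\lambda$ the irrep of $S_n$ (permuting factors); here $d=pq$. If $P_\lambda$ is the projector onto $U_\lambda\otimes V_\lambda$, then $\rho_\lambda=P_\lambda/\mathrm{tr}(P_\lambda)$. $\mathrm{tr}_{\mathbb{C}^q}$ denotes the partial trace over the $\mathbb{C}^q$ factor of each of the $n$ subsystems, giving an operator on $(\mathbb{C}^p)^{\otimes n}$. $\|\cdot\|$ is the trace norm $\|X\|=\mathrm{tr}|X|$. *)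

(* Defs.v *)
From HB Require Import structures.
From mathcomp Require Import all_boot all_order all_algebra all_fingroup.
From mathcomp Require Import algC.
From mathcomp Require Import sesquilinear spectral.
Set Implicit Arguments. Unset Strict Implicit. Unset Printing Implicit Defensive.
Import Order.TTheory GRing.Theory Num.Theory.
Local Open Scope ring_scope.
Local Open Scope sesquilinear_scope.

(* Basis index of (C^d)^{(x) n}: functions 'I_n -> d, d a finite index set. *)
Definition HI (d : finType) (n : nat) : finType := {ffun 'I_n -> d}.

(* Operators on (C^d)^{(x) n}: square matrices over algC, indexed through
   enum_rank/enum_val of HI d n.  Row-vector convention (v *m A). *)
Definition Op (d : finType) (n : nat) := 'M[algC]_#|HI d n|.

Definition is_partition (l : seq nat) (n : nat) : bool :=
  [&& sorted geq l, all (fun x => 0 < x)%N l & sumn l == n].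

Definition in_Par (l : seq nat) (n d : nat) : bool :=
  is_partition l n && (size l <= d)%N.

(* Canonical Young tableau of shape l: boxes filled row by row with 0..n-1.
   rowof l k / colof l k = row / column of the box containing k. *)
Definition rowof (l : seq nat) (k : nat) : nat :=
  \sum_(r < size l) (sumn (take r.+1 l) <= k)%N.
Definition colof (l : seq nat) (k : nat) : nat :=
  (k - sumn (take (rowof l k) l))%N.

Definition rowstab (l : seq nat) (n : nat) (s : 'S_n) : bool :=
  [forall k : 'I_n, rowof l (s k) == rowof l k].
Definition colstab (l : seq nat) (n : nat) (s : 'S_n) : bool :=
  [forall k : 'I_n, colof l (s k) == colof l k].

Definition permop (d : finType) (n : nat) (s : 'S_n) : Op d n :=
  \matrix_(i, j) ((enum_val j == [ffun k => (enum_val i : HI d n) (s k)]) %:R).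

Definition youngop (d : finType) (n : nat) (l : seq nat) : Op d n :=
  \sum_(s : 'S_n | rowstab l s) \sum_(t : 'S_n | colstab l t)
     ((-1) ^+ odd_perm t) *: (permop d s *m permop d t).

(* The l-isotypic subspace of S_n acting on (C^d)^{(x)n}, i.e. the image of the
   two-sided ideal generated by c_l; by Schur-Weyl duality this is U_l (x) V_l. *)
Definition isotypic (d : finType) (n : nat) (l : seq nat) : Op d n :=
  (\sum_(s : 'S_n) \sum_(t : 'S_n)
      <<permop d s *m youngop d n l *m permop d t>>)%MS.

Definition Plam (d : finType) (n : nat) (l : seq nat) : Op d n :=
  proj_ortho (isotypic d n l).
Definition rholam (d : finType) (n : nat) (l : seq nat) : Op d n :=
  (\tr (Plam d n l))^-1 *: Plam d n l.

(* C^{pq} = C^p (x) C^q, basis index 'I_p * 'I_q *)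
Definition pairf (p q n : nat) (a : HI 'I_p n) (b : HI 'I_q n) : HI ('I_p * 'I_q)%type n :=
  [ffun k => (a k, b k)].

Definition ptrq (p q n : nat) (X : Op ('I_p * 'I_q)%type n) : Op 'I_p n :=
  \matrix_(i, j) \sum_(b : HI 'I_q n)
     X (enum_rank (pairf (enum_val i) b)) (enum_rank (pairf (enum_val j) b)).

Definition absmx (m : nat) (X : 'M[algC]_m) : 'M[algC]_m :=
  let A := X ^t* *m X in
  (spectralmx A) ^t* *m diag_mx (map_mx sqrtC (spectral_diag A)) *m spectralmx A.

Definition trnorm (m : nat) (X : 'M[algC]_m) : algC := \tr (absmx X).

(* Main.v *)
Require Import Defs.
From HB Require Import structures.
From mathcomp Require Import all_boot all_order all_algebra all_fingroup.
From mathcomp Require Import algC.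
From mathcomp Require Import sesquilinear spectral.
From mathcomp Require Import lra ring zify.
Set Implicit Arguments. Unset Strict Implicit. Unset Printing Implicit Defensive.
Import Order.TTheory GRing.Theory Num.Theory.
Local Open Scope ring_scope.
Local Open Scope sesquilinear_scope.

(** Let [P] be the projector onto the isotypic subspace. It commutes with every
operator commuting with the permutations, and because [pq >= n] there is a
multi-index [w] with pairwise distinct entries; together these give
[P = \sum_s a_s s]. Positivity of [P] gives [|a_s| <= a_1], hence
[tr P <= a_1 \sum_s (pq)^(cycles of s) = a_1 pq (pq+1) ... (pq+n-1)],
the last sum being counted by Burnside's lemma.

The partial trace of [P] is a sum of positive blocks [<b|P|b>] over
[b : [n] -> [q]], and for injective [b] only [s = 1] contributes, so that
[<b|P|b> = a_1 I]. Thus [tr_q P = a_1 q(q-1)...(q-n+1) I + R] with [R >= 0], and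
the distance to the maximally mixed state is at most
[2 - 2 a_1 q(q-1)...(q-n+1) p^n / tr P], which the bound on [tr P] controls. *)

(** * Orthogonal projectors: self-adjointness and commutation *)

Lemma trCmx_mul (C : numClosedFieldType) m n p (A : 'M[C]_(m, n))
    (B : 'M[C]_(n, p)) : (A *m B) ^t* = B ^t* *m A ^t*.
Proof. by rewrite trmx_mul map_mxM. Qed.

(** The rows of [1 - P] are orthogonal to [U], which contains the rows of [P]. Hence
    [(1 - P) P^* = 0], so [P^* = P P^*], and the right side is self-adjoint. *)
Lemma proj_ortho_herm (C : numClosedFieldType) p n (U : 'M[C]_(p, n)) :
  (proj_ortho U) ^t* = proj_ortho U.
Proof.
set P := proj_ortho U.
have PU : (P <= U)%MS by rewrite -[P]mul1mx proj_ortho_sub.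
have PPt : P *m P ^t* = P ^t*.
  have /orthomx1P UtU := proj_ortho_compl_sub U (1%:M : 'M[C]_n).
  case/submxP: PU => D PD; apply/esym/eqP.
  rewrite -subr_eq0 -{1}(mul1mx (P ^t*)) -mulmxBl {2}PD.
  by rewrite trCmx_mul mulmxA -{1}(mul1mx P) UtU mul0mx.
by have := congr1 (fun M => M ^t* ) PPt; rewrite trCmx_mul trmxCK PPt.
Qed.

(** Stability under [B] gives [P B P = P B]. Stability under the adjoint of [B] gives, after taking
    adjoints, [P B P = B P]. *)
Lemma proj_ortho_comm (C : numClosedFieldType) p n (U : 'M[C]_(p, n))
    (B : 'M[C]_n) :
  (U *m B <= U)%MS -> (U *m B ^t* <= U)%MS ->
  proj_ortho U *m B = B *m proj_ortho U.
Proof.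
set P := proj_ortho U => UB UBt.
have PBP (A : 'M_n) : (U *m A <= U)%MS -> P *m A *m P = P *m A.
  move=> UA; apply/proj_ortho_id/(submx_trans _ UA)/submxMr.
  by rewrite -[P]mul1mx proj_ortho_sub.
have hP : P ^t* = P by apply: proj_ortho_herm.
have := congr1 (fun M => M ^t* ) (PBP _ UBt).
by rewrite trCmx_mul (trCmx_mul P) trmxCK hP mulmxA PBP.
Qed.

(** * Trace norm of Hermitian matrices and positivity *)

Section TraceNorm.
Variable m : nat.
Implicit Types (X A B : 'M[algC]_m).

(** The eigenbases chosen for [X *m X] and for [X] are unrelated, so eigenvalues are not matched
    index by index; the two traces are compared through the unitary change of basis [G]. *)
Lemma trnorm_herm X : X ^t* = X ->
  trnorm X = \sum_i `|spectral_diag X 0 i|.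
Proof.
move=> hX; rewrite /trnorm /absmx hX.
set A := X *m X; set U := spectralmx A; set d := spectral_diag A.
set V := spectralmx X; set x := spectral_diag X.
have Uu : U \is unitarymx by apply: spectral_unitarymx.
have Vu : V \is unitarymx by apply: spectral_unitarymx.
have xr i : x 0 i \is Num.real.
  have /mxOverP : x \is a realmx.
    apply: hermitian_spectral_diag_real.
    by apply/is_hermitianmxP; rewrite expr0 scale1r hX.
  exact.
have Xn : X \is normalmx by apply/normalmxP; rewrite hX.
have hA : A ^t* = A by rewrite trCmx_mul hX.
have An : A \is normalmx by apply/normalmxP; rewrite hA.
have XE : X = V ^t* *m diag_mx x *m V.
  by rewrite -invmx_unitary//; apply/orthomx_spectralP.
have AE : A = U ^t* *m diag_mx d *m U.
  by rewrite -invmx_unitary//; apply/orthomx_spectralP.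
have UtU : U ^t* *m U = 1%:M.
  by rewrite -invmx_unitary// mulVmx// unitarymx_unit.
have VtV : V ^t* *m V = 1%:M.
  by rewrite -invmx_unitary// mulVmx// unitarymx_unit.
have UUt := unitarymxP Uu; have VVt := unitarymxP Vu.
(* [G] intertwines [diag d] and [diag x^2], so it only links indices with
   [d_i = x_j ^ 2] and hence also intertwines their square roots. *)
pose G := U *m V ^t*.
pose x2 : 'rV_m := \row_i (x 0 i ^+ 2).
have AE2 : A = V ^t* *m diag_mx x2 *m V.
  rewrite /A XE !mulmxA; congr (_ *m _).
  rewrite -(mulmxA _ V (V ^t*)) VVt mulmx1 -mulmxA; congr (_ *m _).
  apply/matrixP => i j; rewrite mul_diag_mx !mxE.
  by case: (i == j); rewrite ?mulr1n ?mulr0n ?mulr0// expr2.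
have dG : diag_mx d *m G = G *m diag_mx x2.
  have e1 : U *m A *m V ^t* = diag_mx d *m G.
    by rewrite AE /G !mulmxA UUt mul1mx.
  have e2 : U *m A *m V ^t* = G *m diag_mx x2.
    by rewrite AE2 /G !mulmxA -(mulmxA _ V) VVt mulmx1.
  by rewrite -e1.
set D := diag_mx (map_mx sqrtC d).
pose Dx : 'M[algC]_m := diag_mx (map_mx Num.norm x).
have DG : D *m G = G *m Dx.
  apply/matrixP => i j; move/matrixP/(_ i j): dG.
  rewrite !mul_diag_mx !mul_mx_diag !mxE.
  have [-> | g0] := eqVneq (\sum_j0 U i j0 * V ^t* j0 j) 0.
    by rewrite !mulr0 !mul0r.
  rewrite [RHS]mulrC => /(mulIf g0) ->.
  by rewrite mulrC -(real_normK (xr j)) sqrCK.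
have GGt : G *m G ^t* = 1%:M.
  by rewrite trCmx_mul trmxCK mulmxA -(mulmxA U) VtV mulmx1 UUt.
rewrite mxtrace_mulC mulmxA UUt mul1mx.
have -> : D = G *m Dx *m G ^t* by rewrite -DG -mulmxA GGt mulmx1.
rewrite -mulmxA mxtrace_mulC -mulmxA.
rewrite (mulmx1C GGt) mulmx1 /mxtrace.
by apply: eq_bigr => i _; rewrite !mxE eqxx mulr1n.
Qed.

(** Letting [V] be a whole matrix gives at once the diagonal of [A] in any orthonormal basis, as
    needed in [trnorm_sub_le]. *)
Definition psdmx A :=
  forall k (V : 'M[algC]_(k, m)) i, 0 <= (V *m A *m V ^t* ) i i.

Lemma psdmx_gram k (M : 'M[algC]_(m, k)) : psdmx (M *m M ^t* ).
Proof.
move=> l V i; rewrite !mulmxA -mulmxA -trCmx_mul mxE.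
by apply: sumr_ge0 => j _; rewrite !mxE mul_conjC_ge0.
Qed.

Lemma psdmxD A B : psdmx A -> psdmx B -> psdmx (A + B).
Proof.
by move=> pA pB k V i; rewrite mulmxDr mulmxDl mxE addr_ge0.
Qed.

Lemma psdmxZ (c : algC) A : 0 <= c -> psdmx A -> psdmx (c *: A).
Proof. by move=> c0 pA k V i; rewrite -scalemxAr -scalemxAl mxE mulr_ge0. Qed.

Lemma psdmx1 : psdmx 1%:M.
Proof. by have := @psdmx_gram _ 1%:M; rewrite trmx1 map_mx1 mulmx1. Qed.

Lemma psdmx_sum (I : Type) (r : seq I) (Q : pred I) (F : I -> 'M[algC]_m) :
  (forall i, Q i -> psdmx (F i)) -> psdmx (\sum_(i <- r | Q i) F i).
Proof.
move=> pF; elim/big_ind: _ => //; last exact: psdmxD.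
by have := psdmxZ (lexx 0) psdmx1; rewrite scale0r.
Qed.

(** In an eigenbasis of [A - B], each eigenvalue is a difference of nonnegative diagonal entries of
    [A] and [B], so its modulus is at most their sum. *)
Lemma trnorm_sub_le A B : psdmx A -> psdmx B -> (A - B) ^t* = A - B ->
  trnorm (A - B) <= \tr A + \tr B.
Proof.
move=> pA pB /[dup] hX /trnorm_herm ->.
set X := A - B; set V := spectralmx X.
have Vu : V \is unitarymx by apply: spectral_unitarymx.
have VtV : V ^t* *m V = 1%:M.
  by rewrite -invmx_unitary// mulVmx// unitarymx_unit.
have trV M : \tr M = \sum_i (V *m M *m V ^t* ) i i.
  by rewrite -/(mxtrace (V *m M *m V ^t* )) mxtrace_mulC mulmxA VtV mul1mx.
rewrite !trV -big_split /=; apply: ler_sum => i _.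
have -> : spectral_diag X 0 i = (V *m X *m V ^t* ) i i.
  have /orthomx_spectralP {2}-> : X \is normalmx by apply/normalmxP; rewrite hX.
  rewrite -/V invmx_unitary// !mulmxA (unitarymxP Vu) mul1mx.
  by rewrite -mulmxA (unitarymxP Vu) mulmx1 mxE eqxx mulr1n.
rewrite mulmxBr mulmxBl !mxE.
rewrite (le_trans (ler_normB _ _))// !ger0_norm//.
  by have := pB _ V i; rewrite mxE.
by have := pA _ V i; rewrite mxE.
Qed.
End TraceNorm.

(** * Elementary inequalities for the numerical bound *)

(** Compared factor by factor: with [c = q - n + 1] and [e = n - 1 - i], the inequality
    [(D + e) c <= D (c + e)] amounts to [e c <= D e], and [c <= D]. *)
Lemma rising_falling_le (n q D : nat) : (n <= q)%N -> (q <= D)%N ->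
  ((D + n).-1 ^_ n * (q - n + 1) ^ n <= D ^ n * q ^_ n)%N.
Proof.
case: n => [|n] nq qD; first by rewrite !ffactn0.
rewrite addnS /= !ffact_prod.
have pe (c : nat) : (c ^ n.+1 = \prod_(i < n.+1) c)%N.
  by rewrite prod_nat_const card_ord.
rewrite !pe -!big_split /=; apply: leq_prod => i _.
have := ltn_ord i; set k := nat_of_ord i => ki.
have -> : (D + n - k = D + (n - k))%N by lia.
have cD : (q - n.+1 + 1 <= D)%N by lia.
have -> : (q - k = (q - n.+1 + 1) + (n - k))%N by lia.
move: (q - n.+1 + 1)%N (n - k)%N cD => c e cD.
rewrite mulnDl mulnDr leq_add2l mulnC leq_mul2r; lia.
Qed.

(** Writing [E_n] for the middle term, the induction rests on [E_(n+1) = (1 - x) E_n + n x^2]. *)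
Lemma bernoulli2 (R : realFieldType) (x : R) n : 0 <= x <= 1 ->
  0 <= (1 - x) ^+ n - 1 + n%:R * x <= n%:R ^+ 2 * x ^+ 2.
Proof.
move=> /andP[x0 x1]; elim: n => [|n /andP[IH1 IH2]]; first by rewrite expr0; lra.
have n0 : 0 <= n%:R :> R by apply: ler0n.
rewrite exprS -natr1; move: IH1 IH2; set y := _ ^+ n; set m := n%:R in n0 *.
move=> IH1 IH2.
have h1 : 0 <= (1 - x) * (y - 1 + m * x) by apply: mulr_ge0 => //; lra.
have h2 : 0 <= (1-x) * (m ^+ 2 * x ^+ 2 - (y - 1 + m * x)) by apply: mulr_ge0; lra.
have h3 : 0 <= m * x^+2 by rewrite mulr_ge0 // exprn_ge0.
have h4 : 0 <= x * (m * x)^+2 by rewrite mulr_ge0// exprn_ge0// mulr_ge0.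
have h5 : 0 <= x ^+2 by apply: exprn_ge0.
apply/andP; split; nra.
Qed.

Lemma bound_asymptotics (R : numFieldType) (n q : nat) : (0 < n)%N -> (n <= q)%N ->
  `|(2 - 2 * (((q - n + 1)%:R / q%:R) ^+ n))
        - 2 * n%:R * (n%:R - 1) / q%:R| <= 2 * n%:R ^+ 4 / q%:R ^+ 2 :> R.
Proof.
move=> n0 nq.
(* Both sides are rational numbers: the inequality is proved in totally ordered fields, and its
   instance over [rat] is carried to [R] by [ratr]. *)
suff /(_ rat) H : forall F : realFieldType, 
  `|(2 - 2 * (((q - n + 1)%:R / q%:R) ^+ n))
        - 2 * n%:R * (n%:R - 1) / q%:R| <= 2 * n%:R ^+ 4 / q%:R ^+ 2 :> F.
  rewrite -(ler_rat R) in H.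
  by rewrite ratr_norm !(rmorphXn, rmorphM, rmorphB, fmorphV, rmorph_nat, rmorph1) in H.
move=> {}R.
have q0 : 0 < q%:R :> R by rewrite ltr0n; lia.
have n1 : 1 <= n%:R :> R by rewrite ler1n.
have nq' : n%:R <= q%:R :> R by rewrite ler_nat.
have -> : (q - n + 1)%:R / q%:R = 1 - (n%:R - 1) / q%:R :> R.
  by rewrite natrD natrB //; field; rewrite gt_eqF.
set x := (n%:R - 1) / q%:R.
have x01 : 0 <= x <= 1.
  by rewrite divr_ge0 ?(ltW q0) ?subr_ge0//= ler_pdivrMr// mul1r; lra.
have /andP[h1 h2] := bernoulli2 n x01.
have -> : 2 * n%:R * (n%:R - 1) / q%:R = 2 * (n%:R * x) by rewrite /x; ring.
rewrite ler_norml.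
have h3 : n%:R ^+ 2 * x ^+ 2 <= n%:R ^+ 4 / q%:R ^+ 2.
  rewrite /x expr_div_n mulrA ler_wpM2r ?invr_ge0 ?exprn_ge0 ?(ltW q0)//.
  rewrite (_ : 4%N = (2+2)%N) // exprD ler_wpM2l ?exprn_ge0 ?ler0n//.
  by rewrite lerXn2r ?nnegrE; lra.
apply/andP; split; lra.
Qed.

(** * Counting fixed multi-indices by Burnside's lemma *)

Section Burnside.
Variables (d : finType) (n : nat).

(** A product of permutations applies its left factor first, so precomposing with [s] itself would
    reverse products; the inverse restores the law of an action. *)
Definition precomp_inv (f : {ffun 'I_n -> d}) (s : 'S_n) : {ffun 'I_n -> d} :=
  [ffun k => f ((s^-1)%g k)].

Fact precomp_inv1 : precomp_inv^~ 1%g =1 id.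
Proof. by move=> f; apply/ffunP => k; rewrite ffunE invg1 perm1. Qed.

Fact precomp_invM f : act_morph precomp_inv f.
Proof. by move=> s t; apply/ffunP => k; rewrite !ffunE invMg permM. Qed.

Definition index_action := TotalAction precomp_inv1 precomp_invM.

(** Every orbit contains a sorted sequence, so there are at most as many orbits as sorted [n]-tuples
    over an alphabet of [#|d|] letters. *)
Lemma card_orbits_index : (0 < #|d|)%N ->
  (#|orbit index_action [set: 'S_n] @: [set: {ffun 'I_n -> d}]|
     <= 'C((#|d| + n).-1, n))%N.
Proof.
move=> d0; have eD := prednK d0.
rewrite -{1}eD addSn addnC /= -card_sorted_tuples.
pose c : 'I_#|d|.-1.+1 -> d := fun i => enum_val (cast_ord eD i).
pose c' : d -> 'I_#|d|.-1.+1 := fun x => cast_ord (esym eD) (enum_rank x).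
have c'K : cancel c' c by move=> x; rewrite /c /c' cast_ordKV enum_rankK.
pose F (t : n.-tuple 'I_#|d|.-1.+1) :=
  orbit index_action [set: 'S_n] [ffun k => c (tnth t k)].
rewrite (leq_trans _ (leq_imset_card F _))//; apply: subset_leq_card.
apply/subsetP => _ /imsetP[f _ ->]; apply/imsetP.
pose t0 := [tuple c' (f k) | k < n].
pose r := relpre (val : 'I_#|d|.-1.+1 -> nat) leq.
pose t := sort_tuple r t0.
have /tuple_permP[s ts] : perm_eq t t0 by rewrite perm_sort.
exists t.
  by rewrite inE sorted_map sort_sorted// => x y; apply: leq_total.
apply/orbit_eqP; apply/orbitP; exists s; rewrite ?inE//=.
apply/ffunP => k; rewrite !ffunE.
have -> : t = [tuple tnth t0 (s i) | i < n] by apply: val_inj.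
by rewrite !tnth_mktuple permKV c'K.
Qed.

(** By Burnside the sum is the number of orbits times [n!], and ['C(m, n) * n!] is the falling
    factorial [m ^_ n]. *)
Lemma sum_fixed_indices : (0 < #|d|)%N ->
  (\sum_(f : {ffun 'I_n -> d}) \sum_(s : 'S_n) ([ffun k => f (s k)] == f)
    <= (#|d| + n).-1 ^_ n)%N.
Proof.
move=> d0; rewrite exchange_big /=.
have acts : [acts [set: 'S_n], on [set: {ffun 'I_n -> d}] | index_action].
  by apply/subsetP => s _; rewrite !inE; apply/subsetP => f; rewrite !inE.
have := Frobenius_Cauchy acts.
rewrite (eq_bigl xpredT); last by move=> s; rewrite inE.
rewrite cardsT card_Sn => FC.
rewrite -bin_ffact; apply: leq_trans (leq_mul (card_orbits_index d0) (leqnn _)).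
rewrite -FC; apply: leq_sum => s _.
rewrite -sum1_card [X in (_ <= X)%N]big_mkcond /=; apply: leq_sum => f _.
have [/eqP fs | //] := boolP (_ == _).
suff -> : f \in 'Fix_([set: {ffun 'I_n -> d}] | index_action)[s]%g by [].
apply/setIP; split=> //; apply/afix1P/ffunP => k.
by rewrite ffunE -[in LHS]fs ffunE permKV.
Qed.
End Burnside.

(** * Operators on the tensor power as kernels on multi-indices *)

Section Kernels.
Variables (d : finType) (n : nat).
Local Notation H := (HI d n).
Implicit Types (A B : Op d n) (f g h w : H) (s t : 'S_n).

Definition entry A f g : algC := A (enum_rank f) (enum_rank g).

Definition pcomp f s : H := [ffun k => f (s k)].

Lemma entry_inj A B : entry A =2 entry B -> A = B.
Proof.
move=> AB; apply/matrixP => i j.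
by have := AB (enum_val i) (enum_val j); rewrite /entry !enum_valK.
Qed.

Lemma sum_index (F : 'I_#|H| -> algC) : \sum_i F i = \sum_f F (enum_rank f).
Proof.
rewrite (reindex (@enum_rank H)) //=.
by exists enum_val => i _; rewrite ?enum_rankK ?enum_valK.
Qed.

Lemma entry_mul A B f g :
  entry (A *m B) f g = \sum_h entry A f h * entry B h g.
Proof. by rewrite /entry mxE sum_index. Qed.

Lemma entry_trC A f g : entry (A ^t* ) f g = (entry A g f)^*.
Proof. by rewrite /entry !mxE. Qed.

Lemma entry_permop s f g : entry (permop d s) f g = (g == pcomp f s)%:R.
Proof. by rewrite /entry mxE !enum_rankK. Qed.

Lemma pcomp1 f : pcomp f 1%g = f.
Proof. by apply/ffunP => k; rewrite ffunE perm1. Qed.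

Lemma pcompM f s t : pcomp (pcomp f s) t = pcomp f (t * s)%g.
Proof. by apply/ffunP => k; rewrite !ffunE permM. Qed.

Lemma pcomp_inj s : injective (pcomp^~ s).
Proof.
by move=> f g /(congr1 (pcomp^~ s^-1)%g); rewrite /= !pcompM mulVg !pcomp1.
Qed.

Lemma pcomp_injl f s t : injective f -> pcomp f s = pcomp f t -> s = t.
Proof.
move=> fi /ffunP e; apply/permP => k; apply: fi.
by have := e k; rewrite !ffunE.
Qed.

Lemma permopM s t : permop d s *m permop d t = permop d (t * s)%g.
Proof.
apply: entry_inj => f g; rewrite entry_mul entry_permop (bigD1 (pcomp f s)) //=.
rewrite !entry_permop eqxx mul1r pcompM big1 ?addr0// => h /negbTE hf.
by rewrite entry_permop hf mul0r.
Qed.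

Lemma permop1 : permop d (1%g : 'S_n) = 1%:M.
Proof.
apply: entry_inj => f g; rewrite entry_permop pcomp1 /entry mxE.
by rewrite (inj_eq enum_rank_inj) eq_sym.
Qed.

(** This is the commutant of the permutation operators, phrased on entries so that it can be checked
    on explicit kernels. *)
Definition perm_invariant A :=
  forall s f g, entry A (pcomp f s) (pcomp g s) = entry A f g.

Lemma perm_invariant_trC A : perm_invariant A -> perm_invariant (A ^t* ).
Proof. by move=> iA s f g; rewrite !entry_trC iA. Qed.

Lemma perm_invariant_comm A s :
  perm_invariant A -> permop d s *m A = A *m permop d s.
Proof.
move=> iA; apply: entry_inj => f g; rewrite !entry_mul.
rewrite (bigD1 (pcomp f s)) //= entry_permop eqxx mul1r big1 ?addr0; last first.
  by move=> h /negbTE hf; rewrite entry_permop hf mul0r.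
have gE : g = pcomp (pcomp g s^-1%g) s by rewrite pcompM mulgV pcomp1.
rewrite (bigD1 (pcomp g s^-1%g)) //= big1 ?addr0; last first.
  move=> h hg; rewrite entry_permop {1}gE.
  by rewrite (inj_eq (@pcomp_inj s)) eq_sym (negbTE hg) mulr0.
by rewrite entry_permop -gE eqxx mulr1 -(iA s f) -gE.
Qed.

(** * Entries and trace of the isotypic projector *)

(** [A] commutes with every generator [M] of the ideal, and the row space of [M A = A M] lies in
    that of [M]. *)
Lemma isotypic_stable l A : perm_invariant A ->
  (isotypic d n l *m A <= isotypic d n l)%MS.
Proof.
move=> iA; rewrite /isotypic sumsmxMr_gen; apply/sumsmx_subP => s _.
rewrite (sumsmx_sup s) ?genmxE// sumsmxMr_gen; apply/sumsmx_subP => t _.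
rewrite (sumsmx_sup t) ?genmxE//.
rewrite (eqmxMr _ (genmxE _)).
suff -> : permop d s *m youngop d n l *m permop d t *m A
     = A *m (permop d s *m youngop d n l *m permop d t) by rewrite submxMl.
have yA : youngop d n l *m A = A *m youngop d n l.
  rewrite /youngop mulmx_suml mulmx_sumr; apply: eq_bigr => s1 _.
  rewrite mulmx_suml mulmx_sumr; apply: eq_bigr => t1 _.
  by rewrite permopM -scalemxAl -scalemxAr perm_invariant_comm.
rewrite -mulmxA (perm_invariant_comm t iA) mulmxA -(mulmxA (permop d s)) yA.
by rewrite mulmxA (perm_invariant_comm s iA) !mulmxA.
Qed.

Lemma Plam_comm l A : perm_invariant A ->
  Plam d n l *m A = A *m Plam d n l.
Proof.
move=> iA; apply: proj_ortho_comm; first exact: isotypic_stable.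
exact/isotypic_stable/perm_invariant_trC.
Qed.

Lemma Plam_herm l : (Plam d n l) ^t* = Plam d n l.
Proof. exact: proj_ortho_herm. Qed.

Lemma Plam_gram l : Plam d n l *m (Plam d n l) ^t* = Plam d n l.
Proof. by rewrite Plam_herm [LHS]proj_ortho_proj. Qed.

Lemma entry_Plam l w f g : injective w ->
  entry (Plam d n l) f g =
    \sum_s entry (Plam d n l) w (pcomp w s) * (g == pcomp f s)%:R.
Proof.
(* [B] is permutation invariant and sends the basis vector [w] to [f]; comparing
   [P B] and [B P] at [w] transports row [w] of [P] to row [f]. *)
move=> wi; pose B : Op d n := \matrix_(i, j)
  \sum_(s : 'S_n) ((enum_val i == pcomp w s) && (enum_val j == pcomp f s))%:R.
have BE x y : entry B x y =
    \sum_(s : 'S_n) ((x == pcomp w s) && (y == pcomp f s))%:R.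
  by rewrite /entry mxE !enum_rankK.
have iB : perm_invariant B.
  move=> s x y; rewrite !BE (reindex_inj (mulgI s)) /=.
  by apply: eq_bigr => t _; rewrite -!pcompM !(inj_eq (@pcomp_inj s)).
(* Injectivity of [w] leaves only the term [s = 1]. *)
have Bw y : entry B w y = (y == f)%:R.
  rewrite BE (bigD1 1%g) //= !pcomp1 eqxx /= big1 ?addr0// => s s1.
  have [e|//] := w =P pcomp w s; case/eqP: s1.
  by apply: (pcomp_injl wi); rewrite pcomp1.
have := congr1 (fun A => entry A w g) (Plam_comm l iB).
rewrite /= !entry_mul [RHS](bigD1 f) //= Bw eqxx mul1r.
rewrite [X in _ = _ + X -> _]big1 ?addr0; last first.
  by move=> h hf; rewrite Bw (negbTE hf) mul0r.
move=> <-; rewrite (eq_bigr (fun x => \sum_(s : 'S_n) entry (Plam d n l) w x *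
   ((x == pcomp w s) && (g == pcomp f s))%:R)); last first.
  by move=> x _; rewrite BE mulr_sumr.
rewrite exchange_big /=; apply: eq_bigr => s _.
rewrite (bigD1 (pcomp w s)) //= eqxx /= big1 ?addr0// => h /negbTE->.
by rewrite mulr0.
Qed.

Lemma entry_Plam_diag l w f : injective w -> injective f ->
  entry (Plam d n l) f f = entry (Plam d n l) w w.
Proof.
move=> wi fi; rewrite (entry_Plam l f f wi) (bigD1 1%g) //= !pcomp1 eqxx mulr1.
rewrite big1 ?addr0// => s s1; case: eqP => [e|_]; last by rewrite mulr0.
by case/eqP: s1; apply: (pcomp_injl fi); rewrite pcomp1.
Qed.

Lemma entry_Plam_gram l f g : entry (Plam d n l) f g =
  \sum_h entry (Plam d n l) f h * (entry (Plam d n l) g h)^*.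
Proof.
by rewrite -{1}Plam_gram entry_mul; apply: eq_bigr => h _; rewrite entry_trC.
Qed.

Lemma entry_Plam_ge0 l f : 0 <= entry (Plam d n l) f f.
Proof.
by rewrite entry_Plam_gram; apply: sumr_ge0 => h _; rewrite mul_conjC_ge0.
Qed.

(** The entry is an inner product of rows [w] and [pcomp w s] of [P]. These have the same squared
    norm [entry P w w], so the mean inequality applied termwise plays the part of Cauchy-Schwarz. *)
Lemma entry_Plam_le l w s : injective w ->
  `|entry (Plam d n l) w (pcomp w s)| <= entry (Plam d n l) w w.
Proof.
move=> wi; set P := Plam d n l.
have wsi : injective (pcomp w s).
  by move=> i j; rewrite !ffunE => /wi/perm_inj.
have e : entry P w w =
    (entry P w w + entry P (pcomp w s) (pcomp w s)) / 2.
  by rewrite (entry_Plam_diag l wi wsi) -mulr2n -[_ *+ 2]mulr_natr mulfK// pnatr_eq0.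
rewrite e /P !entry_Plam_gram -/P -big_split /= mulr_suml.
apply: le_trans (ler_norm_sum _ _ _) _; apply: ler_sum => h _.
rewrite normrM norm_conjC -!normCK.
exact: (real_leif_mean_square (normr_real _) (normr_real _)).1.
Qed.

Lemma trace_Plam l : \tr (Plam d n l) = \sum_f entry (Plam d n l) f f.
Proof. by rewrite /mxtrace sum_index. Qed.

Lemma trace_Plam_le l w : (0 < #|d|)%N -> injective w ->
  \tr (Plam d n l) <= entry (Plam d n l) w w * ((#|d| + n).-1 ^_ n)%:R.
Proof.
move=> d0 wi; set P := Plam d n l.
have t0 : 0 <= \tr P by rewrite trace_Plam sumr_ge0// => f _; apply: entry_Plam_ge0.
(* The nonnegative trace is replaced by its modulus, so that the triangle inequality applies to the
   expansion over permutations. *)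
rewrite -(ger0_norm t0) trace_Plam.
apply: (@le_trans _ _ (\sum_f \sum_(s : 'S_n) entry P w w * (f == pcomp f s)%:R)).
  apply: le_trans (ler_norm_sum _ _ _) _; apply: ler_sum => f _.
  rewrite (entry_Plam l f f wi); apply: le_trans (ler_norm_sum _ _ _) _.
  apply: ler_sum => s _; rewrite normrM normr_nat ler_wpM2r ?ler0n//.
  exact: entry_Plam_le.
under eq_bigr => f _ do rewrite -mulr_sumr.
rewrite -mulr_sumr ler_wpM2l ?entry_Plam_ge0//.
under eq_bigr => f _ do rewrite -natr_sum.
rewrite -natr_sum ler_nat.
apply: leq_trans (sum_fixed_indices n d0).
by apply: leq_sum => f _; apply: leq_sum => s _; rewrite eq_sym.
Qed.

End Kernels.

(** * Nonvanishing of the Young symmetriser and of the projector *)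

(** This makes the subtraction in [colof] exact, so that row and column together determine a box. *)
Lemma sumn_take_rowof l k : (sumn (take (rowof l k) l) <= k)%N.
Proof.
have mono i j : (i <= j)%N -> (sumn (take i l) <= sumn (take j l))%N.
  move=> ij; rewrite -(cat_take_drop i (take j l)) sumn_cat.
  by rewrite take_takel// leq_addr.
case: (posnP (rowof l k)) => [->|r0]; first by rewrite take0.
case: leqP => // kr; exfalso.
suff: (rowof l k <= (rowof l k).-1)%N by rewrite -ltnS prednK// ltnn.
rewrite {1}/rowof.
have rs : ((rowof l k).-1 <= size l)%N.
  rewrite -ltnS prednK// ltnW// ltnS.
  rewrite -[X in (_ <= X)%N]card_ord -sum1_card.
  by apply: leq_sum => r _; apply: leq_b1.
(* If the first [rowof l k] rows held more than [k] boxes, then, partial sums being monotone, no row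
   from index [(rowof l k).-1] on would be counted, leaving too small a count. *)
rewrite (bigID (fun r : 'I__ => (r < (rowof l k).-1)%N)) /=.
rewrite [X in (_ + X)%N]big1 ?addn0; last first.
  move=> r; rewrite -leqNgt => hr; apply/eqP; rewrite eqb0 -ltnNge.
  apply: (leq_trans kr); apply: mono.
  by rewrite -ltnS prednK// in hr.
rewrite -(big_ord_widen _ (fun r => (sumn (take r.+1 l) <= k)%N : nat)) //.
rewrite -[X in (_ <= X)%N]card_ord -sum1_card.
by apply: leq_sum => r _; apply: leq_b1.
Qed.

(** Here [t] is inverse to [s], so [k] and [s k] share a row because of [s] and a column because of
    [t]; they are then the same box. *)
Lemma rowstab_colstab_eq1 l n (s t : 'S_n) :
  rowstab l s -> colstab l t -> (t * s)%g = 1%g -> s = 1%g.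
Proof.
move=> /forallP rs /forallP ct ts; apply/permP => k; rewrite perm1.
have e : (t (s k) = k).
  have st : (s * t)%g = 1%g.
    have -> : s = (t^-1)%g by apply/eqP; rewrite eq_sym eq_invg_mul ts.
    by rewrite mulVg.
  by rewrite -permM st perm1.
have /eqP rk := rs k; have := ct (s k); rewrite e => /eqP ck.
apply: val_inj => /=.
by rewrite -(subnKC (sumn_take_rowof l (s k))) -/(colof l (s k)) -ck rk
           subnKC// sumn_take_rowof.
Qed.

(** A product [permop s *m permop t] has a nonzero entry at [(w, w)] only if [t * s = 1], which
    forces [s = t = 1]. *)
Lemma entry_youngop (d : finType) n l (w : HI d n) : injective w ->
  entry (youngop d n l) w w = 1.
Proof.
move=> wi; have eS A B : entry (A + B) w w = entry A w w + entry B w w.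
  by rewrite /entry mxE.
have e0 : entry (0 : Op d n) w w = 0 by rewrite /entry mxE.
rewrite /youngop (big_morph _ eS e0).
rewrite (bigD1 1%g) /=; last by apply/forallP => k; rewrite perm1.
rewrite [X in _ + X]big1 ?addr0 => [|s /andP[rs s1]]; rewrite (big_morph _ eS e0).
  rewrite (bigD1 1%g) /=; last by apply/forallP => k; rewrite perm1.
  rewrite odd_perm1 expr0 scale1r permopM mulg1 entry_permop pcomp1 eqxx.
  rewrite big1 ?addr0// => t /andP[ct t1].
  rewrite permopM mulg1 /entry mxE -/(entry _ w w) entry_permop.
  have [e|_] := w =P _; last by rewrite mulr0.
  by case/eqP: t1; apply: (pcomp_injl wi); rewrite pcomp1.
apply: big1 => t ct.
rewrite permopM /entry mxE -/(entry _ w w) entry_permop.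
have [e|_] := w =P _; last by rewrite mulr0.
case/eqP: s1; apply: (rowstab_colstab_eq1 rs ct).
by apply: (pcomp_injl wi); rewrite pcomp1.
Qed.

(** A diagonal entry of [P] is the squared norm of its row, so a zero trace would give [P = 0],
    although the isotypic subspace contains the nonzero Young symmetriser. *)
Lemma trace_Plam_gt0 (d : finType) n l (w : HI d n) : injective w ->
  0 < \tr (Plam d n l).
Proof.
move=> wi; set P := Plam d n l.
rewrite lt_def trace_Plam sumr_ge0 ?andbT; last by move=> f _; apply: entry_Plam_ge0.
apply/eqP => t0; have P0 : P = 0.
  apply: entry_inj => f g; rewrite [RHS]mxE.
  have /eqP : entry P f f = 0.
    by move/psumr_eq0P: t0; apply => // h _; apply: entry_Plam_ge0.
  rewrite entry_Plam_gram psumr_eq0; last by move=> h _; rewrite mul_conjC_ge0.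
  move/allP/(_ g (mem_index_enum _)) => /=.
  by rewrite mul_conjC_eq0 => /eqP.
have : (youngop d n l <= isotypic d n l)%MS.
  rewrite (sumsmx_sup (1%g : 'S_n)) // (sumsmx_sup (1%g : 'S_n)) // genmxE.
  by rewrite permop1 mul1mx mulmx1.
rewrite -(proj_orthoE (isotypic d n l)) -[proj_ortho _]/P P0 submx0 => /eqP y0.
have := entry_youngop l wi; rewrite y0 /entry mxE => /eqP.
by rewrite eq_sym oner_eq0.
Qed.

(** * Partial trace of the projector as a sum of positive blocks *)

Section PartialTrace.
Variables (p q n : nat).
Local Notation d := ('I_p * 'I_q)%type.

Lemma ptrqE (X : Op d n) a a' :
  entry (ptrq X) a a' = \sum_b entry X (pairf a b) (pairf a' b).
Proof. by rewrite /entry mxE !enum_rankK. Qed.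

Lemma ptrqZ c (X : Op d n) : ptrq (c *: X) = c *: ptrq X.
Proof.
apply/matrixP => i j; rewrite !mxE mulr_sumr.
by apply: eq_bigr => b _; rewrite mxE.
Qed.

Lemma ptrq_trC (X : Op d n) : (ptrq X) ^t* = ptrq (X ^t* ).
Proof.
apply: entry_inj => a a'; rewrite entry_trC !ptrqE rmorph_sum.
by apply: eq_bigr => b _; rewrite entry_trC.
Qed.

Lemma pairf_bij : bijective (fun ab : HI 'I_p n * HI 'I_q n => pairf ab.1 ab.2).
Proof.
exists (fun f : HI d n => ([ffun k => (f k).1], [ffun k => (f k).2])).
  by case=> a b; congr pair; apply/ffunP => k; rewrite !ffunE.
by move=> f; apply/ffunP => k; rewrite !ffunE -surjective_pairing.
Qed.

Lemma trace_ptrq (X : Op d n) : \tr (ptrq X) = \tr X.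
Proof.
rewrite /mxtrace !sum_index (reindex _ (onW_bij _ pairf_bij)) /=.
rewrite -(pair_bigA _ (fun a b => X (enum_rank (pairf a b)) (enum_rank (pairf a b)))) /=.
by apply: eq_bigr => a _; rewrite -/(entry _ a a) ptrqE.
Qed.

Lemma pairf_injr a (b : HI 'I_q n) : injective b ->
  injective (pairf a b : HI ('I_p * 'I_q)%type n).
Proof. by move=> bi i j; rewrite !ffunE => -[_ /bi]. Qed.

(** The rectangular block [<b|X], with all columns kept: since [P = P P^*], its Gram matrix for
    [X = P] is [<b|P|b>], visibly positive. *)
Definition ptrq_block (X : Op d n) (b : HI 'I_q n) :
    'M[algC]_(#|HI 'I_p n|, #|HI d n|) :=
  \matrix_(i, j) X (enum_rank (pairf (enum_val i) b)) j.

Lemma entry_ptrq_block l b a a' :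
  entry (ptrq_block (Plam d n l) b *m (ptrq_block (Plam d n l) b) ^t* ) a a'
    = entry (Plam d n l) (pairf a b) (pairf a' b).
Proof.
rewrite entry_Plam_gram /entry mxE sum_index; apply: eq_bigr => h _.
by rewrite !mxE !enum_rankK.
Qed.

Lemma ptrq_PlamE l : ptrq (Plam d n l) =
  \sum_b ptrq_block (Plam d n l) b *m (ptrq_block (Plam d n l) b) ^t*.
Proof.
apply: entry_inj => a a'; rewrite ptrqE /entry summxE; apply: eq_bigr => b _.
by rewrite -/(entry _ a a') entry_ptrq_block.
Qed.

Lemma ptrq_block_inj l (w : HI d n) (b : HI 'I_q n) : injective w -> injective b ->
  ptrq_block (Plam d n l) b *m (ptrq_block (Plam d n l) b) ^t*
    = entry (Plam d n l) w w *: 1%:M.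
Proof.
move=> wi bi; apply: entry_inj => a a'; rewrite entry_ptrq_block.
rewrite {2}/entry !mxE (inj_eq enum_rank_inj).
have [->|aa'] := eqVneq a a'.
  by rewrite mulr1 (entry_Plam_diag l wi (@pairf_injr a' b bi)).
rewrite mulr0 (entry_Plam l _ _ wi) big1// => s _.
have [/ffunP e|_] := _ =P _; last by rewrite mulr0.
(* Equality of the second components reads [b = pcomp b s], and [b] is injective. *)
have s1 : s = 1%g.
  apply/permP => k; rewrite perm1; apply: bi.
  by have := e k; rewrite !ffunE => -[].
case/eqP: aa'; apply/ffunP => k.
by have := e k; rewrite !ffunE s1 perm1 => -[].
Qed.

Lemma ptrq_Plam_decomp l (w : HI d n) : injective w ->
  exists2 R, psdmx R & ptrq (Plam d n l) =
    (entry (Plam d n l) w w * (q ^_ n)%:R) *: 1%:M + R.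
Proof.
move=> wi; rewrite ptrq_PlamE (bigID (fun b : HI 'I_q n => injectiveb b)) /=.
exists (\sum_(b : HI 'I_q n | ~~ injectiveb b)
  ptrq_block (Plam d n l) b *m (ptrq_block (Plam d n l) b) ^t* ).
  by apply: psdmx_sum => b _; apply: psdmx_gram.
congr (_ + _).
rewrite (eq_bigr (fun=> entry (Plam d n l) w w *: 1%:M)); last first.
  by move=> b /injectiveP bi; apply: ptrq_block_inj.
rewrite sumr_const -scaler_nat scalerA mulrC; congr ((_ * _%:R) *: _).
have := card_inj_ffuns 'I_n 'I_q; rewrite !card_ord cardsE => <-.
by apply: eq_card.
Qed.

End PartialTrace.

Theorem theorem2 :
  (forall (p q n : nat) (l : seq nat),
     (0 < p)%N -> (0 < q)%N -> (0 < n)%N -> (n <= q)%N ->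
     in_Par l n (p * q) ->
     trnorm (ptrq (rholam ('I_p * 'I_q)%type n l) - ((p ^ n)%:R)^-1 *: 1%:M)
       <= 2 - 2 * (((q - n + 1)%:R / q%:R) ^+ n))
  /\
  (exists C : algC, forall n q : nat, (0 < n)%N -> (n <= q)%N ->
     `|(2 - 2 * (((q - n + 1)%:R / q%:R) ^+ n))
        - 2 * n%:R * (n%:R - 1) / q%:R| <= C * n%:R ^+ 4 / q%:R ^+ 2).
Proof.
split; last by exists 2 => n q n0 nq; apply: bound_asymptotics.
move=> p q n l p0 q0 n0 nq _; set d := ('I_p * 'I_q)%type.
(* The second components [0, ..., n-1] are distinct and fit into ['I_q] because [n <= q]. *)
pose w : HI d n := [ffun k => (Ordinal p0, widen_ord nq k)].
have wi : injective w.
  by move=> i j; rewrite !ffunE => -[] /= ij; apply: val_inj.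
have cd : #|{: d}| = (p * q)%N by rewrite card_prod !card_ord.
have d0 : (0 < #|{: d}|)%N by rewrite cd muln_gt0 p0.
have t0 := trace_Plam_gt0 l wi; have tle := trace_Plam_le l d0 wi.
have [R pR PE] := ptrq_Plam_decomp l wi.
rewrite /rholam ptrqZ; move: t0 tle.
have hE : ptrq (Plam d n l) ^t* = ptrq (Plam d n l) by rewrite ptrq_trC Plam_herm.
have trE := trace_ptrq (Plam d n l); rewrite PE in trE hE *.
set t := \tr (Plam d n l); set a := entry _ _ _ => t0 tle.
have tr1 : \tr (1%:M : Op 'I_p n) = (p ^ n)%:R.
  by rewrite mxtrace1 card_ffun !card_ord.
have trR : 0 <= \tr R.
  apply: sumr_ge0 => i _; have := pR _ 1%:M i.
  by rewrite trmx1 map_mx1 mulmx1 mul1mx.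
have P0 : 0 < (p ^ n)%:R :> algC by rewrite ltr0n expn_gt0 p0.
have {}trE : \tr R = t - a * (q ^_ n)%:R * (p ^ n)%:R.
  by rewrite /t -trE mxtraceD mxtraceZ tr1 addrAC subrr add0r.
(* [c] is the coefficient of the identity split off from the reduced state, and [b] is what it lacks
   to reach [1 / p^n]. The difference becomes [t^-1 R - b I], two positive parts each of trace
   [1 - c p^n]. *)
pose c := t^-1 * (a * (q ^_ n)%:R).
pose b := ((p ^ n)%:R)^-1 - c.
have XE : t^-1 *: ((a * (q ^_ n)%:R) *: 1%:M + R) - ((p ^ n)%:R)^-1 *: 1%:M
    = t^-1 *: R - b *: (1%:M : Op 'I_p n).
  by rewrite scalerDr scalerA -/c /b scalerBl opprB addrCA addrA.
have b0 : 0 <= b.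
  rewrite subr_ge0 -[X in _ <= X]mul1r ler_pdivlMr// /c -mulrA mulrC.
  by rewrite ler_pdivrMr// mul1r -subr_ge0 -trE.
rewrite XE; apply: le_trans (trnorm_sub_le _ _ _) _.
- by apply: psdmxZ => //; rewrite invr_ge0 ltW.
- exact/psdmxZ/psdmx1.
(* The scalars are real and the partial trace of [P] is Hermitian, hence so is the difference. *)
- rewrite -XE; apply/matrixP => i j.
  have := congr1 (fun M : Op 'I_p n => M i j) hE.
  rewrite !mxE rmorphB !rmorphM !fmorphV /= !conjC_nat => ->.
  have -> : t^* = t by apply/CrealP/ger0_real/ltW.
  by rewrite (eq_sym j).
rewrite !mxtraceZ tr1 trE; set r := _ / _.
have tN0 : t != 0 by rewrite gt_eqF.
have PN0 : (p ^ n)%:R != 0 :> algC by rewrite gt_eqF.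
have -> : t^-1 * (t - a * (q ^_ n)%:R * (p ^ n)%:R) + b * (p ^ n)%:R
    = 2 - 2 * (c * (p ^ n)%:R) by rewrite /b /c; field; apply/andP.
rewrite lerD2l lerN2 ler_pM2l ?ltr0n//.
have q0' : 0 < q%:R :> algC by rewrite ltr0n.
rewrite /r expr_div_n ler_pdivrMr ?exprn_gt0// /c -!mulrA mulrC ler_pdivlMr//.
have a0 : 0 <= a by apply: entry_Plam_ge0.
(* Once the trace is replaced by its upper bound, the factor [a] cancels and [rising_falling_le]
   with [D = p q] remains. *)
apply: le_trans (ler_wpM2l (exprn_ge0 _ (ler0n _ _)) tle) _.
rewrite mulrCA ler_wpM2l// -!natrX -!natrM ler_nat cd mulnC.
apply: leq_trans (rising_falling_le nq (leq_pmull _ p0)) _.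
by rewrite expnMn mulnC mulnA.
Qed.
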